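(* For every $p\in[1,2]$ the Banach ring $\ell_p$ is Hirsch.
   Context: Let $\mathbb F$ be the field of real or complex numbers. For $p\in[1,\infty)$, $\ell_p$ is the Banach space of all functions $x:\omega\to\mathbb F$ with finite norm $\|x\|_{\ell_p}=\big(\sum_{n\in\omega}|x(n)|^p\big)^{1/p}$; endowed with pointwise multiplication of functions it is a Banach ring. A series $\sum_{n\in\omega}x_n$ in an Abelian topological group $G$ unconditionally converges to $x\in G$ if for any neighborhood $U$ of $0$ there is a finite set $F\subset\omega$ such that $\sum_{i\in J}x_i\in x+U$ for any finite set $J\subset\omega$ containing $F$; it is unconditionally convergent if it unconditionally converges to some $x\in G$. A topological ring $R$ is Hirsch if for any unconditionally convergent series $\sum_{n\in\omega}x_n$ in $R$ and any neighborhood $U\subseteq R$ of $0$ there exists a neighborhood $V\subseteq R$ of $0$ such that $\sum_{n\in F}a_nx_n\in U$ for any finite set $F\subset\omega$ and any sequence $(a_n)_{n\in F}\in V^F$. *)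

(* Defs.v *)
From HB Require Import structures.
From mathcomp Require Import all_boot all_order all_algebra.
From mathcomp Require Import finmap.
From mathcomp Require Import complex.
From mathcomp Require Import all_classical all_reals all_analysis.

Set Implicit Arguments.
Unset Strict Implicit.
Unset Printing Implicit Defensive.

Import Order.TTheory GRing.Theory Num.Theory.
Import numFieldTopology.Exports numFieldNormedType.Exports.

Local Open Scope classical_set_scope.
Local Open Scope ring_scope.

(* The rings of MathComp are unital, but the ring l_p is not: its unit would
   have to be the constant function 1. Hence the following structures. *)

HB.mixin Record Zmodule_isRng V of GRing.Zmodule V := {
  rmul : V -> V -> V;
  rmulA : associative rmul;
  rmulDl : left_distributive rmul +%R;
  rmulDr : right_distributive rmul +%R
}.

#[short(type="rngType")]
HB.structure Definition Rng := {V of GRing.Zmodule V & Zmodule_isRng V}.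

HB.mixin Record isTopologicalRng V of TopologicalZmodule V & Rng V := {
  rmul_continuous : continuous (fun x : V * V => rmul x.1 x.2)
}.

#[short(type="topologicalRngType")]
HB.structure Definition TopologicalRng :=
  {V of TopologicalZmodule V & Rng V & isTopologicalRng V}.

Declare Scope rng_scope.
Delimit Scope rng_scope with rng.
Notation "x * y" := (rmul x y) : rng_scope.

Definition unconditionally_converges_to (G : topologicalZmodType)
    (x : nat -> G) (l : G) : Prop :=
  forall U : set G, nbhs 0 U ->
    exists F : {fset nat}, forall J : {fset nat}, (F `<=` J)%fset ->
      [set l + u | u in U] (\sum_(i <- J) x i).

Definition unconditionally_convergent (G : topologicalZmodType)
    (x : nat -> G) : Prop :=
  exists l : G, unconditionally_converges_to x l.

Definition Hirsch (T : topologicalRngType) : Prop :=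
  forall x : nat -> T, unconditionally_convergent x ->
  forall U : set T, nbhs 0 U ->
  exists2 V : set T, nbhs 0 V &
    forall (F : {fset nat}) (a : nat -> T), (forall n, n \in F -> V (a n)) ->
      U (\sum_(n <- F) (a n * x n)%rng).

Variant scalar_kind := RealScalars | ComplexScalars.

Definition scalar_field (R : realType) (k : scalar_kind) : fieldType :=
  match k with RealScalars => R | ComplexScalars => R[i] end.

Definition modulus (R : realType) (k : scalar_kind) : scalar_field R k -> R :=
  match k with
  | RealScalars => fun x : R => `|x|
  | ComplexScalars => fun x : R[i] => Normc.normc x
  end.

Section modulus.
Context (R : realType) (k : scalar_kind).
Implicit Types x y : scalar_field R k.

Lemma ler_modulusD x y : modulus (x + y) <= modulus x + modulus y.
Proof. by case: k x y => /= x y; [exact: ler_normD|exact: le_normcD]. Qed.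

Lemma modulus_eq0 x : modulus x = 0 -> x = 0.
Proof. by case: k x => /= x; [exact: normr0_eq0|exact: Normc.eq0_normc]. Qed.

Lemma modulusMn x n : modulus (x *+ n) = modulus x *+ n.
Proof. by case: k x => /= x; [exact: normrMn|exact: normcMn]. Qed.

Lemma modulusN x : modulus (- x) = modulus x.
Proof. by case: k x => /= x; [exact: normrN|exact: normcN]. Qed.

Lemma modulusM x y : modulus (x * y) = modulus x * modulus y.
Proof. by case: k x y => /= x y; [exact: normrM|exact: Normc.normcM]. Qed.

End modulus.

(* The library norm of R[i] takes its values in R[i]; the carrier below has the
   modulus, with values in R, as its norm. *)
Definition scalars (R : realType) (k : scalar_kind) : Type := scalar_field R k.

HB.instance Definition _ (R : realType) (k : scalar_kind) :=
  GRing.Field.copy (scalars R k) (scalar_field R k).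

HB.instance Definition _ (R : realType) (k : scalar_kind) :=
  Num.Zmodule_isNormed.Build R (scalars R k) (@ler_modulusD R k)
    (@modulus_eq0 R k) (@modulusMn R k) (@modulusN R k).

Lemma scalar_normE (R : realType) (k : scalar_kind) (x : scalars R k) :
  `|x| = modulus x.
Proof. by []. Qed.

Lemma scalar_normM (R : realType) (k : scalar_kind) (x y : scalars R k) :
  `|x * y| = `|x| * `|y|.
Proof. exact: modulusM. Qed.

Section lpnorm.
Context (R : realType) (k : scalar_kind) (p : R).
Implicit Types x y : nat -> scalars R k.

Definition lpnorm x : \bar R :=
  ((\sum_(0 <= n <oo) (`|x n| `^ p)%R%:E) `^ p^-1)%E.

Lemma lpnorm_ge0 x : (0 <= lpnorm x)%E.
Proof. exact: poweR_ge0. Qed.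

Lemma lpnorm_Lnorm x : 0 < p ->
  lpnorm x = 'N[counting]_p%:E[EFin \o (fun n => `|x n|)%R]%E.
Proof.
move=> p0; rewrite Lnorm_counting// /lpnorm; congr (_ `^ _)%E.
by apply: eq_eseriesr => n _ /=; rewrite normr_id.
Qed.

Lemma le_lpnorm x y : 0 < p -> (forall n, `|x n| <= `|y n|) ->
  (lpnorm x <= lpnorm y)%E.
Proof.
move=> p0 xy; apply: gt0_ler_poweR; first by rewrite invr_ge0 ltW.
- by rewrite in_itv/= leey andbT nneseries_ge0// => n _ _;
  rewrite lee_fin powR_ge0.
- by rewrite in_itv/= leey andbT nneseries_ge0// => n _ _;
  rewrite lee_fin powR_ge0.
apply: lee_nneseries => [n _ _|n _]; first by rewrite lee_fin powR_ge0.
by rewrite lee_fin ge0_ler_powR ?nnegrE ?(ltW p0)//.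
Qed.

Lemma lpnormD x y : 1 <= p -> (lpnorm (x + y)%R <= lpnorm x + lpnorm y)%E.
Proof.
move=> p1; have p0 : 0 < p by exact: lt_le_trans p1.
rewrite (lpnorm_Lnorm x)// (lpnorm_Lnorm y)//.
have mN (z : nat -> scalars R k) : measurable_fun setT (fun n => `|z n|).
  by [].
apply: le_trans (minkowski_EFin counting (mN x) (mN y) p1).
rewrite lpnorm_Lnorm// !Lnorm_counting//.
apply: gt0_ler_poweR; first by rewrite invr_ge0 ltW.
- by rewrite in_itv/= leey andbT nneseries_ge0// => n _ _;
  rewrite lee_fin powR_ge0.
- by rewrite in_itv/= leey andbT nneseries_ge0// => n _ _;
  rewrite lee_fin powR_ge0.
apply: lee_nneseries => [n _ _|n _]; first by rewrite lee_fin powR_ge0.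
rewrite lee_fin ge0_ler_powR ?nnegrE ?(ltW p0)//= normr_id.
by rewrite (le_trans (ler_normD _ _))// ler_norm.
Qed.

Lemma lpnormN x : lpnorm (- x) = lpnorm x.
Proof.
by rewrite /lpnorm; under eq_eseriesr do rewrite [(- x) _]/(- x _) normrN.
Qed.

Lemma lpnorm0 : 0 < p -> lpnorm 0 = 0%E.
Proof.
move=> p0; rewrite /lpnorm eseries0.
  by rewrite poweR_EFin powR0// invr_eq0 gt_eqF.
move=> n _ _.
by rewrite normr0 powR0// gt_eqF.
Qed.

Lemma le_norm_lpnorm x n : 0 < p -> (`|x n|%R%:E <= lpnorm x)%E.
Proof.
move=> p0.
have -> : `|x n|%:E = ((`|x n| `^ p)%R%:E `^ p^-1)%E.
  by rewrite poweR_EFin -powRrM mulfV ?gt_eqF// powRr1.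
apply: gt0_ler_poweR; first by rewrite invr_ge0 ltW.
- by rewrite in_itv/= leey andbT lee_fin powR_ge0.
- by rewrite in_itv/= leey andbT nneseries_ge0// => i _ _;
  rewrite lee_fin powR_ge0.
rewrite (@nneseriesD1 _ _ n)//.
by apply: leeDl; apply: nneseries_ge0 => i _ _; rewrite lee_fin powR_ge0.
Qed.

Lemma lpnorm_eq0 x : 0 < p -> lpnorm x = 0%E -> x = 0.
Proof.
move=> p0 x0; apply/funext => n; apply/eqP; rewrite -normr_eq0 eq_le normr_ge0.
by rewrite andbT -lee_fin (le_trans (le_norm_lpnorm _ _ p0))// x0.
Qed.

Lemma lpnormZ x c : 0 < p -> 0 <= c ->
  ((\sum_(0 <= n <oo) ((c * `|x n|) `^ p)%R%:E) `^ p^-1)%E =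
  (c%:E * lpnorm x)%E.
Proof.
move=> p0 c0; rewrite /lpnorm.
under eq_eseriesr do rewrite powRM// EFinM.
rewrite nneseriesZl; last by move=> i _; rewrite lee_fin powR_ge0.
rewrite poweRM ?lee_fin ?powR_ge0//; last first.
  by rewrite nneseries_ge0// => i _ _; rewrite lee_fin powR_ge0.
by rewrite poweR_EFin -powRrM mulfV ?gt_eqF// powRr1.
Qed.

Lemma lpnormMn x m : 0 < p ->
  lpnorm (fun n => x n *+ m)%R = (m%:R%:E * lpnorm x)%E.
Proof.
move=> p0; rewrite -lpnormZ//; congr (_ `^ _)%E.
by apply: eq_eseriesr => n _; rewrite normrMn mulr_natl.
Qed.

Lemma lpnormM x y : 0 < p -> (lpnorm x < +oo)%E ->
  (lpnorm (fun n => x n * y n)%R <= lpnorm x * lpnorm y)%E.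
Proof.
move=> p0 xoo; set c := fine (lpnorm x).
have c0 : 0 <= c by rewrite fine_ge0// lpnorm_ge0.
have xE : lpnorm x = c%:E by rewrite fineK// ge0_fin_numE ?lpnorm_ge0.
rewrite xE -lpnormZ//; apply: gt0_ler_poweR; first by rewrite invr_ge0 ltW.
- by rewrite in_itv/= leey andbT nneseries_ge0// => n _ _;
  rewrite lee_fin powR_ge0.
- by rewrite in_itv/= leey andbT nneseries_ge0// => n _ _;
  rewrite lee_fin powR_ge0.
apply: lee_nneseries => [n _ _|n _]; first by rewrite lee_fin powR_ge0.
rewrite lee_fin ge0_ler_powR ?nnegrE ?mulr_ge0 ?(ltW p0)//.
by rewrite scalar_normM ler_wpM2r// -lee_fin -xE le_norm_lpnorm.
Qed.

End lpnorm.

Definition ellp_pred (R : realType) (k : scalar_kind) (p : R) :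
    {pred nat -> scalars R k} := [pred x | (lpnorm p x < +oo)%E].

(* The proof of 1 <= p is a parameter of the type because the norm axioms depend
   on it. *)
Record ellp (R : realType) (k : scalar_kind) (p : R) (p1 : 1 <= p) := Ellp {
  ellp_fun :> nat -> scalars R k;
  ellp_fun_pred : ellp_fun \in @ellp_pred R k p
}.

Section ellp.
Context (R : realType) (k : scalar_kind) (p : R) (p1 : 1 <= p).
Local Notation ell := (@ellp R k p p1).

Let p0 : 0 < p. Proof. exact: lt_le_trans p1. Qed.

HB.instance Definition _ := [isSub for @ellp_fun R k p p1].
HB.instance Definition _ := [Choice of ell by <:].

Lemma ellp_finite (x : ell) : (lpnorm p x < +oo)%E.
Proof. exact: ellp_fun_pred. Qed.

Lemma ellp_zmod_closed : zmod_closed (@ellp_pred R k p).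
Proof.
split=> [|x y]; rewrite !inE; first by rewrite lpnorm0.
move=> xoo yoo; apply: le_lt_trans (lpnormD _ _ p1) _.
by rewrite lpnormN lte_add_pinfty.
Qed.

HB.instance Definition _ :=
  GRing.isZmodClosed.Build (nat -> scalars R k) (@ellp_pred R k p)
    ellp_zmod_closed.
HB.instance Definition _ := [SubChoice_isSubZmodule of ell by <:].

Lemma ellpD (x y : ell) n : (x + y) n = x n + y n.
Proof. by []. Qed.

Lemma ellpN (x : ell) n : (- x) n = - x n.
Proof. by []. Qed.

Definition ellp_norm (x : ell) : R := fine (lpnorm p x).

Lemma ellp_normE (x : ell) : (ellp_norm x)%:E = lpnorm p x.
Proof. by rewrite fineK// ge0_fin_numE ?lpnorm_ge0 ?ellp_finite. Qed.

Lemma ler_ellp_normD (x y : ell) :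
  ellp_norm (x + y) <= ellp_norm x + ellp_norm y.
Proof. by rewrite -lee_fin EFinD !ellp_normE; exact: lpnormD. Qed.

Lemma ellp_norm_eq0 (x : ell) : ellp_norm x = 0 -> x = 0.
Proof.
move=> x0; apply: val_inj; apply: (lpnorm_eq0 p0).
by rewrite -ellp_normE x0.
Qed.

Lemma ellp_normN (x : ell) : ellp_norm (- x) = ellp_norm x.
Proof. by rewrite /ellp_norm lpnormN. Qed.

Lemma ellp_coeMn (x : ell) m n : (x *+ m) n = x n *+ m.
Proof. by elim: m => [|m IH]; rewrite ?mulr0n// !mulrS -IH. Qed.

Lemma ellp_normMn (x : ell) m : ellp_norm (x *+ m) = ellp_norm x *+ m.
Proof.
apply: EFin_inj; rewrite -mulr_natl EFinM !ellp_normE -lpnormMn//.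
by congr lpnorm; apply/funext => n; exact: ellp_coeMn.
Qed.

HB.instance Definition _ := Num.Zmodule_isNormed.Build R ell
  ler_ellp_normD ellp_norm_eq0 ellp_normMn ellp_normN.
HB.instance Definition _ := PseudoMetric.copy ell (pseudoMetric_normed ell).
HB.instance Definition _ := isPointed.Build ell 0.
HB.instance Definition _ := NormedZmod_PseudoMetric_eq.Build R ell erefl.
HB.instance Definition _ := PreTopologicalNmodule_isTopologicalNmodule.Build ell
  (@pseudometric_normed_Zmodule.add_continuous R ell).
HB.instance Definition _ := TopologicalNmodule_isTopologicalZmodule.Build ell
  (@oppr_continuous R ell).

Lemma ellp_mul_finite (x y : ell) : (lpnorm p (fun n => x n * y n)%R < +oo)%E.
Proof.
apply: le_lt_trans (lpnormM _ p0 (ellp_finite x)) _.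
by rewrite -!ellp_normE -EFinM ltry.
Qed.

Definition ellp_mul (x y : ell) : ell := Ellp p1 (ellp_mul_finite x y).

Lemma ellp_mulE (x y : ell) n : ellp_mul x y n = x n * y n.
Proof. by []. Qed.

Lemma ellp_mulA : associative ellp_mul.
Proof. by move=> x y z; apply/val_inj/funext => n /=; rewrite mulrA. Qed.

Lemma ellp_mulDl : left_distributive ellp_mul +%R.
Proof. by move=> x y z; apply/val_inj/funext => n; exact: mulrDl. Qed.

Lemma ellp_mulDr : right_distributive ellp_mul +%R.
Proof. by move=> x y z; apply/val_inj/funext => n; exact: mulrDr. Qed.

HB.instance Definition _ :=
  Zmodule_isRng.Build ell ellp_mulA ellp_mulDl ellp_mulDr.

Lemma ellp_lpnormE (x : ell) : `|x|%:E = lpnorm p x.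
Proof. exact: ellp_normE. Qed.

Lemma ler_ellp_normM (x y : ell) : `|(x * y)%rng| <= `|x| * `|y|.
Proof.
by rewrite -lee_fin EFinM !ellp_lpnormE; apply: lpnormM (ellp_finite x).
Qed.

Lemma ellp_mul_continuous : continuous (fun x : ell * ell => (x.1 * x.2)%rng).
Proof.
move=> [a b]; apply/cvgrPdist_lt => /= e e0.
pose M := `|a| + `|b| + 1; have M0 : 0 < M by rewrite ltr_wpDl ?addr_ge0.
pose d := Num.min 1 (e / M).
have d0 : 0 < d by rewrite lt_min ltr01 divr_gt0.
have near_a : \forall z \near (a, b), `|a - z.1| < d.
  have ca := @cvg_fst ell ell (nbhs a) (nbhs b) _.
  exact: (@cvgrPdist_lt R ell _ (nbhs (a, b)) _ fst a).1 (ca _) _ d0.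
have near_b : \forall z \near (a, b), `|b - z.2| < d.
  have cb := @cvg_snd ell ell (nbhs a) (nbhs b) _.
  exact: (@cvgrPdist_lt R ell _ (nbhs (a, b)) _ snd b).1 (cb _) _ d0.
near=> z.
have az : `|a - z.1| < d by near: z.
have bz : `|b - z.2| < d by near: z.
have zb : `|z.2| <= `|b| + 1.
  rewrite -[z.2](subKr b) (le_trans (ler_normB _ _))// lerD2l.
  by rewrite (le_trans (ltW bz))// ge_min lexx.
have -> : ellp_mul a b - ellp_mul z.1 z.2 =
    (a * (b - z.2))%rng + ((a - z.1) * z.2)%rng.
  apply/val_inj/funext => n.
  rewrite -[RHS]/(a n * (b n - z.2 n) + (a n - z.1 n) * z.2 n).
  by rewrite mulrBr mulrBl subrKA.
apply: le_lt_trans (ler_normD _ _) _.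
apply: le_lt_trans (lerD (ler_ellp_normM _ _) (ler_ellp_normM _ _)) _.
apply: (@lt_le_trans _ _ (d * M)); last first.
  by rewrite -ler_pdivlMr// ge_min lexx orbT.
rewrite /M -addrA mulrDr ler_ltD//; first by rewrite mulrC ler_wpM2r// ltW.
apply: le_lt_trans (ler_wpM2l (normr_ge0 _) zb) _.
by rewrite ltr_pM2r// ltr_wpDl.
Unshelve. all: by end_near. Qed.

HB.instance Definition _ := isTopologicalRng.Build ell ellp_mul_continuous.

End ellp.

(* Main.v *)
(* Unconditional convergence bounds all finite partial sums of [x] by some [M].
   Let [z = \sum_n a_n x_n] with [|a_n| <= e], and let [y] have [|y_i| = |z_i|^(p-1)],
   so that [Z = \sum_i |z_i|^p] is at most [\sum_n \sum_i |a_n(i)| |x_n(i) y_i|].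
   As [p <= 2], the l_2 norm of [a_n] is at most [e], so Cauchy-Schwarz leaves
   [e \sum_n |x_n y|_2], and Khinchine's inequality replaces each l_2 norm by an
   average over signs [s] of [|\sum_i s_i x_n(i) y_i|]. For a fixed choice of [s],
   passing to a subset [J] of the indices [n] bounds the sum of these moduli by
   [4 |\sum_i s_i y_i w_i|] with [w = \sum_(n in J) x_n], hence [|w| <= M].
   Young's inequality on [|z_i|^(p-1) |w_i|] then absorbs half of [Z]. *)
Require Import Defs.
From mathcomp Require Import all_boot all_order all_algebra.
From mathcomp Require Import finmap complex ring lra.
From mathcomp Require Import all_classical all_reals all_analysis.

Set Implicit Arguments.
Unset Strict Implicit.
Unset Printing Implicit Defensive.

Import Order.TTheory GRing.Theory Num.Theory.
Import numFieldTopology.Exports numFieldNormedType.Exports.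

Local Open Scope ring_scope.

(** * Averages over random signs *)

Section SignAverage.
Context (R : realType).
Implicit Types f g : seq bool -> R.

(** The expectation over [N] independent fair signs; conditioning on the first sign lets moments be
    computed by induction. *)
Fixpoint sign_avg (N : nat) f : R :=
  if N is N'.+1 then
    (sign_avg N' (fun e => f (true :: e)) + sign_avg N' (fun e => f (false :: e)))
      / 2
  else f [::].

Lemma eq_sign_avg N f g : f =1 g -> sign_avg N f = sign_avg N g.
Proof.
elim: N f g => [|N IH] f g fg /=; first exact: fg.
by congr ((_ + _) / 2); apply: IH => e; exact: fg.
Qed.

Lemma sign_avgD N f g :
  sign_avg N (fun e => f e + g e) = sign_avg N f + sign_avg N g.
Proof. by elim: N f g => [//|N IH] f g /=; rewrite !IH; field. Qed.

Lemma sign_avgZ N c f : sign_avg N (fun e => c * f e) = c * sign_avg N f.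
Proof. by elim: N f => [//|N IH] f /=; rewrite !IH; field. Qed.

Lemma sign_avg0 N : sign_avg N (fun=> 0) = 0.
Proof. by elim: N => [//|N /= ->]; rewrite addr0 mul0r. Qed.

Lemma sign_avg_sum N (I : Type) (r : seq I) (f : I -> seq bool -> R) :
  sign_avg N (fun e => \sum_(i <- r) f i e) = \sum_(i <- r) sign_avg N (f i).
Proof.
elim: r => [|i r IH].
  rewrite big_nil -[RHS](sign_avg0 N).
  by apply: eq_sign_avg => e; rewrite big_nil.
rewrite big_cons -IH -sign_avgD.
by apply: eq_sign_avg => e; rewrite big_cons.
Qed.

Lemma le_sign_avg N f g : (forall e, f e <= g e) -> sign_avg N f <= sign_avg N g.
Proof.
elim: N f g => [|N IH] f g fg /=; first exact: fg.
by rewrite ler_pM2r ?invr_gt0// lerD// IH// => e; exact: fg.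
Qed.

(** Later replaces an average by one choice of signs common to all terms of a sum. *)
Lemma sign_avg_le_value N f : exists e, sign_avg N f <= f e.
Proof.
elim: N f => [|N IH] f /=; first by exists [::].
have [e1 h1] := IH (fun e => f (true :: e)).
have [e2 h2] := IH (fun e => f (false :: e)).
have [h|h] := leP (f (true :: e1)) (f (false :: e2)).
  by exists (false :: e2); lra.
by exists (true :: e1); lra.
Qed.

End SignAverage.

(** * Khinchine's inequality through second and fourth moments *)

Section Khinchine.
Context (R : realType) (k : scalar_kind).
Local Notation V := (scalars R k).
Implicit Types (a : nat -> V) (s x y : V).

Lemma scalar_parallelogram x y :
  `|x + y| ^+ 2 + `|x - y| ^+ 2 = 2 * (`|x| ^+ 2 + `|y| ^+ 2).
Proof.
rewrite !scalar_normE; case: k x y => /= x y.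
  by rewrite !real_normK ?num_real//; ring.
case: x y => [x1 x2] [y1 y2] /=.
by rewrite !sqr_sqrtr ?addr_ge0 ?sqr_ge0//; ring.
Qed.

Lemma scalar_norm_surj (t : R) : 0 <= t -> exists y : V, `|y| = t.
Proof.
move=> t0; case: k => /=.
  by exists (t : scalars R RealScalars); rewrite scalar_normE /= ger0_norm.
exists ((t%:C)%C : scalars R ComplexScalars).
by rewrite scalar_normE /= expr0n /= addr0 sqrtr_sqr ger0_norm.
Qed.

(** The parallelogram law gives the sum of the squares of [|x + y|] and [|x - y|], and their product
    is [|x^2 - y^2|], at least [||x|^2 - |y|^2|]. *)
Lemma scalar_fourth_moment x y :
  `|x + y| ^+ 4 + `|x - y| ^+ 4 <=
  2 * (`|x| ^+ 2 + `|y| ^+ 2) ^+ 2 + 8 * (`|x| ^+ 2 * `|y| ^+ 2).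
Proof.
have par := scalar_parallelogram x y.
have pr : `|(`|x| ^+ 2 - `|y| ^+ 2)| <= `|x + y| * `|x - y|.
  rewrite -scalar_normM.
  have -> : (x + y) * (x - y) = x * x - y * y by rewrite -!expr2 subr_sqr mulrC.
  by rewrite !expr2 -!scalar_normM; exact: ler_dist_dist.
have pr2 : (`|x| ^+ 2 - `|y| ^+ 2) ^+ 2 <= `|x + y| ^+ 2 * `|x - y| ^+ 2.
  by rewrite -exprMn -[leLHS]real_normK ?num_real// lerXn2r ?nnegrE// mulr_ge0.
set P := `|x + y| in par pr2 *; set Q := `|x - y| in par pr2 *.
have -> : P ^+ 4 + Q ^+ 4 = (P ^+ 2 + Q ^+ 2) ^+ 2 - 2 * (P ^+ 2 * Q ^+ 2) by ring.
rewrite par; move: pr2; set A := `|x| ^+ 2; set B := `|y| ^+ 2 => pr2.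
lra.
Qed.

(** [true] encodes the sign -1; a list shorter than [N] is padded with signs +1. *)
Definition signed_sum a N (e : seq bool) : V :=
  \sum_(i < N) (-1) ^+ nth false e i * a i.

Lemma signed_sum_cons a N b e :
  signed_sum a N.+1 (b :: e) =
  (-1) ^+ b * a 0 + signed_sum (fun i => a i.+1) N e.
Proof. by rewrite /signed_sum big_ord_recl. Qed.

Lemma norm_signed_sum_le a N e : `|signed_sum a N e| <= \sum_(i < N) `|a i|.
Proof.
apply: le_trans (ler_norm_sum _ _ _) _; apply: ler_sum => i _.
by case: (nth _ _ _); rewrite ?expr1 ?expr0 ?mul1r// mulN1r normrN.
Qed.

(** The cross terms cancel by the parallelogram law. The free offset [s] absorbs the first signed
    term in the induction. *)
Lemma sign_avg_norm2 N a s :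
  sign_avg N (fun e => `|s + signed_sum a N e| ^+ 2) =
  `|s| ^+ 2 + \sum_(i < N) `|a i| ^+ 2.
Proof.
elim: N a s => [|N IH] a s /=; first by rewrite /signed_sum !big_ord0 !addr0.
under eq_sign_avg do rewrite signed_sum_cons mulN1r addrA.
under [X in (_ + X) / 2]eq_sign_avg do rewrite signed_sum_cons mul1r addrA.
rewrite !IH big_ord_recl; have := scalar_parallelogram s (a 0) => /=.
lra.
Qed.

Lemma sign_avg_norm4 N a s :
  sign_avg N (fun e => `|s + signed_sum a N e| ^+ 4) <=
  `|s| ^+ 4 + 6 * (`|s| ^+ 2 * \sum_(i < N) `|a i| ^+ 2)
    + 3 * (\sum_(i < N) `|a i| ^+ 2) ^+ 2.
Proof.
elim: N a s => [|N IH] a s /=; first by rewrite /signed_sum !big_ord0 !addr0; lra.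
under eq_sign_avg do rewrite signed_sum_cons mulN1r addrA.
under [X in (_ + X) / 2]eq_sign_avg do rewrite signed_sum_cons mul1r addrA.
have h1 := IH (fun i => a i.+1) (s - a 0).
have h2 := IH (fun i => a i.+1) (s + a 0).
have := scalar_parallelogram s (a 0); have := scalar_fourth_moment s (a 0).
rewrite big_ord_recl /=.
move: h1 h2; set B := \sum_(i < N) _; set A := `|s|; set b := `|a _|.
set P := `|s + a 0|; set Q := `|s - a 0|.
move=> h1 h2 h4 par.
have : Q ^+ 2 * B + P ^+ 2 * B = 2 * (A ^+ 2 + b ^+ 2) * B.
  by rewrite -mulrDl [Q ^+ 2 + _]addrC par.
(* After expansion the two sides differ by [2 * b ^+ 4]. *)
have := sqr_ge0 (b ^+ 2).
lra.
Qed.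

(* [u >= u^2 - u^4 / 4] for [u = |signed_sum| / sigma >= 0] bounds the first
   moment below by the second and the fourth. *)
Lemma khinchine a N :
  Num.sqrt (\sum_(i < N) `|a i| ^+ 2) <=
  4 * sign_avg N (fun e => `|signed_sum a N e|).
Proof.
set B := \sum_(i < N) _; set t := Num.sqrt B.
have B0 : 0 <= B by apply: sumr_ge0 => i _; exact: sqr_ge0.
have tB : t ^+ 2 = B by rewrite sqr_sqrtr.
have [t0|t0] := leP t 0.
  apply: (le_trans t0); apply: mulr_ge0 => //.
  by rewrite -[leLHS](sign_avg0 R N); apply: le_sign_avg => e.
have m2 : sign_avg N (fun e => `|signed_sum a N e| ^+ 2) = t ^+ 2.
  rewrite tB -[RHS]add0r -[X in X + B](expr0n R 2) -(normr0 V) -sign_avg_norm2.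
  by apply: eq_sign_avg => e; rewrite add0r.
have m4 : sign_avg N (fun e => `|signed_sum a N e| ^+ 4) <= 3 * t ^+ 4.
  have := sign_avg_norm4 N a 0; rewrite normr0 !expr0n/= mul0r mulr0 !add0r -/B -tB.
  rewrite -exprM; apply: le_trans; apply: le_sign_avg => e.
  by rewrite add0r.
have h : sign_avg N (fun e => t ^- 1 * `|signed_sum a N e| ^+ 2
    + (- (4^-1 * t ^- 3)) * `|signed_sum a N e| ^+ 4) <=
    sign_avg N (fun e => `|signed_sum a N e|).
  apply: le_sign_avg => e; set s := `|_|.
  have s0 : 0 <= s by exact: normr_ge0.
  pose u := s / t; have u0 : 0 <= u by rewrite divr_ge0// ltW.
  have -> : s = t * u by rewrite /u mulrC divfK// gt_eqF.
  have -> : t ^- 1 * (t * u) ^+ 2 + - (4^-1 * t ^- 3) * (t * u) ^+ 4 =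
     t * (u ^+ 2 - u ^+ 4 / 4) by field; rewrite gt_eqF.
  rewrite ler_pM2l//.
  have : 0 <= u * (1 - u + u ^+ 3 / 4).
    rewrite mulr_ge0//.
    (* 7/6 approximates the minimizer [2 / sqrt 3] of [1 - u + u^3 / 4], and 7/3 makes the quadratic
       term vanish. *)
    have : 0 <= (u - 7/6) ^+ 2 * (u + 7/3).
      by rewrite mulr_ge0 ?sqr_ge0// addr_ge0//.
    lra.
  lra.
move: h; rewrite sign_avgD !sign_avgZ m2.
have -> : t ^- 1 * t ^+ 2 = t by field; rewrite gt_eqF.
have : 4^-1 * t ^- 3 * sign_avg N (fun e => `|signed_sum a N e| ^+ 4) <=
    4^-1 * t ^- 3 * (3 * t ^+ 4).
  by rewrite ler_wpM2l// mulr_ge0// invr_ge0 exprn_ge0// ltW.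
(* What remains is [t - 3/4 t = t / 4], whence the factor 4. *)
have -> : 4^-1 * t ^- 3 * (3 * t ^+ 4) = 3 / 4 * t by field; rewrite gt_eqF.
lra.
Qed.

End Khinchine.

(** * Inequalities for finite sums of scalars *)

Section ScalarSums.
Context (R : realType) (k : scalar_kind).
Local Notation V := (scalars R k).

(* [J] is one of the two subsets of [F] on which [phi (c n)] has constant sign. *)
Lemma sum_norm_le_subset (phi : {additive V -> R}) (F : {fset nat}) (c : nat -> V) :
  (forall z, `|phi z| <= `|z|) ->
  exists J : {fset nat}, \sum_(n <- F) `|phi (c n)| <= 2 * `|\sum_(n <- J) c n|.
Proof.
move=> phi_le; pose P n := 0 <= phi (c n).
pose J1 := [fset n in F | P n]%fset; pose J2 := [fset n in F | ~~ P n]%fset.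
have h1 : \sum_(n <- J1) `|phi (c n)| <= `|\sum_(n <- J1) c n|.
  apply: le_trans (phi_le _); rewrite raddf_sum.
  rewrite big_seq [X in `|X|]big_seq.
  rewrite (eq_bigr (fun n => phi (c n))); first exact: ler_norm.
  by move=> n; rewrite !inE => /andP[_ /ger0_norm].
have h2 : \sum_(n <- J2) `|phi (c n)| <= `|\sum_(n <- J2) c n|.
  apply: le_trans (phi_le _); rewrite raddf_sum -normrN -sumrN.
  rewrite big_seq [X in `|X|]big_seq.
  rewrite (eq_bigr (fun n => - phi (c n))); first exact: ler_norm.
  by move=> n; rewrite !inE => /andP[_]; rewrite -ltNge => /ltr0_norm.
rewrite (big_fsetID _ P) /= -/J1 -/J2.
have [h|h] := leP `|\sum_(n <- J1) c n| `|\sum_(n <- J2) c n|.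
  by exists J2; lra.
by exists J1; lra.
Qed.

End ScalarSums.

(** Over the complex numbers, the real and the imaginary parts each cost a factor 2; the better of
    their two subsets serves for both. *)
Lemma sum_modulus_le_subset (R : realType) (k : scalar_kind) (F : {fset nat})
    (c : nat -> scalars R k) :
  exists J : {fset nat}, \sum_(n <- F) `|c n| <= 4 * `|\sum_(n <- J) c n|.
Proof.
case: k c => c.
  pose phi : {additive scalars R RealScalars -> R} := (idfun : {additive R -> R}).
  have [z|J hJ] := @sum_norm_le_subset R RealScalars phi F c.
    by [].
  exists J; apply: le_trans hJ _.
  by rewrite ler_wpM2r// ler_nat.
pose Re' : {additive scalars R ComplexScalars -> R} := (@complex.Re R : {additive R[i] -> R}).
pose Im' : {additive scalars R ComplexScalars -> R} := (@complex.Im R : {additive R[i] -> R}).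
have Re_le (z : scalars R ComplexScalars) : `|Re' z| <= `|z|.
  rewrite scalar_normE; case: z => x y /=.
  by rewrite -sqrtr_sqr ler_wsqrtr// lerDl sqr_ge0.
have Im_le (z : scalars R ComplexScalars) : `|Im' z| <= `|z|.
  rewrite scalar_normE; case: z => x y /=.
  by rewrite -sqrtr_sqr ler_wsqrtr// lerDr sqr_ge0.
have norm_le (z : scalars R ComplexScalars) : `|z| <= `|Re' z| + `|Im' z|.
  rewrite scalar_normE; case: z => x y /=.
  rewrite -[leRHS]ger0_norm ?addr_ge0// -sqrtr_sqr ler_wsqrtr//.
  rewrite sqrrD !real_normK ?num_real// lerD2r lerDl mulrn_wge0// mulr_ge0//.
have [J1 h1] := sum_norm_le_subset F c Re_le.
have [J2 h2] := sum_norm_le_subset F c Im_le.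
have h : \sum_(n <- F) `|c n| <=
    \sum_(n <- F) `|Re' (c n)| + \sum_(n <- F) `|Im' (c n)|.
  by rewrite -big_split /=; apply: ler_sum => n _; exact: norm_le.
have [hJ|hJ] := leP `|\sum_(n <- J1) c n| `|\sum_(n <- J2) c n|.
  by exists J2; lra.
by exists J1; lra.
Qed.

(** Cauchy-Schwarz, from expanding the nonnegative sum of [(t * f i - e * g i) ^+ 2] with [t] the
    l_2 norm of [g]. *)
Lemma sum_mul_le_sqrt (R : realType) (N : nat) (f g : nat -> R) (e : R) :
  0 < e -> \sum_(i < N) f i ^+ 2 <= e ^+ 2 ->
  \sum_(i < N) f i * g i <= e * Num.sqrt (\sum_(i < N) g i ^+ 2).
Proof.
move=> e0 fe; set B := \sum_(i < N) g i ^+ 2; set t := Num.sqrt B.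
have B0 : 0 <= B by apply: sumr_ge0 => i _; exact: sqr_ge0.
have tB : t ^+ 2 = B by rewrite sqr_sqrtr.
have t0 : 0 <= t by exact: sqrtr_ge0.
have [tpos|tneg] := ltP 0 t; last first.
  have B_0 : B = 0 by rewrite -tB (@le_anti _ _ t 0) ?tneg// expr0n.
  rewrite big1 ?mulr_ge0 ?(ltW e0)// => i _.
  have /eqP := psumr_eq0P (fun (j : 'I_N) _ => sqr_ge0 (g j)) B_0 (i := i) isT.
  by rewrite sqrf_eq0 => /eqP ->; rewrite mulr0.
rewrite -subr_ge0.
have : 0 <= \sum_(i < N) (t * f i - e * g i) ^+ 2.
  by apply: sumr_ge0 => i _; exact: sqr_ge0.
have -> : \sum_(i < N) (t * f i - e * g i) ^+ 2 =
    t ^+ 2 * (\sum_(i < N) f i ^+ 2) + (e ^+ 2) * B - 2 * t * e * \sum_(i < N) f i * g i.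
  rewrite /B !mulr_sumr -sumrN -!big_split /=; apply: eq_bigr => i _; ring.
rewrite -tB => h.
have h2 : t ^+ 2 * (\sum_(i < N) f i ^+ 2) <= t ^+ 2 * e ^+ 2.
  by rewrite ler_wpM2l// sqr_ge0.
rewrite -(@pmulr_rge0 _ (t * e)) ?mulr_gt0//.
lra.
Qed.

(** * Norm estimates in l_p and the Hirsch bound *)

Section UnconditionalConvergence.
Context (R : realType) (k : scalar_kind) (p : R) (p1 : 1 <= p).
Local Notation ell := (@ellp R k p p1).

(** The sum over [J] is the sum over the union of [F] and [J], within 1 of [l], minus a sum over a
    subset of the fixed [F]. *)
Lemma unconditionally_convergent_bounded (x : nat -> ell) :
  unconditionally_convergent x ->
  exists2 M : R, 0 < M & forall J : {fset nat}, `|\sum_(n <- J) x n| <= M.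
Proof.
move=> [l /(_ [set y : ell | `|y| < 1]%classic)].
case; first by apply/nbhs_norm0P; exists 1 => /=.
move=> F hF; exists (`|l| + 1 + \sum_(n <- F) `|x n|) => [|J].
  by apply: ltr_wpDr; [apply: sumr_ge0 => n _; exact: normr_ge0|rewrite ltr_wpDl].
have [u /= u1 uE] := hF (F `|` J)%fset (fsubsetUl _ _).
pose D := [fset n in F | n \notin J]%fset.
have EJ : [fset n in (F `|` J)%fset | n \in J]%fset = J.
  by apply/fsetP => n; rewrite !inE; case: (n \in J); rewrite ?orbT ?andbF.
have ED : [fset n in (F `|` J)%fset | n \notin J]%fset = D.
  by apply/fsetP => n; rewrite !inE; case: (n \in J); rewrite ?orbF ?andbF.
have -> : \sum_(n <- J) x n = \sum_(n <- (F `|` J)%fset) x n - \sum_(n <- D) x n.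
  by rewrite [X in X - _](big_fsetID _ (fun n => n \in J)) /= EJ ED addrK.
apply: le_trans (ler_normB _ _) _; rewrite -uE; apply: lerD.
  by apply: le_trans (ler_normD _ _) _; rewrite lerD2l ltW.
apply: le_trans (ler_norm_sum _ _ _) _; rewrite -big_fset_condE.
rewrite [leRHS](bigID (fun n => n \in J)) /= lerDr.
by apply: sumr_ge0 => n _; exact: normr_ge0.
Qed.

Let p0 : 0 < p. Proof. exact: lt_le_trans p1. Qed.

Lemma ellp_series (x : ell) :
  (\sum_(0 <= n <oo) (`|x n| `^ p)%:E = (`|x| `^ p)%:E)%E.
Proof.
rewrite -poweR_EFin ellp_lpnormE /lpnorm -poweRrM mulVf ?gt_eqF//.
by rewrite poweRe1// nneseries_ge0// => n _ _; rewrite lee_fin powR_ge0.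
Qed.

Lemma ellp_sum_le (x : ell) N : \sum_(n < N) `|x n| `^ p <= `|x| `^ p.
Proof.
rewrite -lee_fin -ellp_series -sumEFin.
rewrite -(big_mkord xpredT (fun n => (`|x n| `^ p)%:E)).
by apply: nneseries_lim_ge => n _ _; rewrite lee_fin powR_ge0.
Qed.

Lemma ellp_norm_le (x : ell) (B : R) : 0 <= B ->
  (forall N, \sum_(n < N) `|x n| `^ p <= B `^ p) -> `|x| <= B.
Proof.
move=> B0 h; rewrite leNgt; apply/negP => /(gt0_ltr_powR p0).
rewrite !nnegrE => /(_ B0 (normr_ge0 _)).
rewrite ltNge -lee_fin -ellp_series => /negP; apply.
apply: lime_le.
  by apply: is_cvg_nneseries => n _ _; rewrite lee_fin powR_ge0.
by apply: nearW => N; rewrite big_mkord sumEFin lee_fin.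
Qed.

Lemma ellp_coord_le (x : ell) n : `|x n| <= `|x|.
Proof. by rewrite -lee_fin ellp_lpnormE le_norm_lpnorm. Qed.

(* [l_p] embeds contractively into [l_2]. *)
Lemma ellp_sum_sqr_le (x : ell) (e : R) N : p <= 2 -> 0 < e -> `|x| <= e ->
  \sum_(n < N) `|x n| ^+ 2 <= e ^+ 2.
Proof.
move=> p2 e0 xe.
(* On [0, 1] squares are at most [p]-th powers, as [p <= 2]. *)
have u01 n : 0 <= `|x n| / e <= 1.
  rewrite divr_ge0 ?(ltW e0)//= ler_pdivrMr// mul1r.
  exact: le_trans (ellp_coord_le _ _) xe.
have le_pow n : (`|x n| / e) ^+ 2 <= (`|x n| / e) `^ p.
  have /andP[u0 u1] := u01 n; move: u0; rewrite le_eqVlt => /predU1P[<-|u0].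
    by rewrite expr0n/= powR_ge0.
  by rewrite -powR_mulrn ?(ltW u0)// ger_powR// u0 u1.
have -> : \sum_(n < N) `|x n| ^+ 2 = e ^+ 2 * \sum_(n < N) (`|x n| / e) ^+ 2.
  rewrite mulr_sumr; apply: eq_bigr => n _.
  by rewrite -exprMn mulrC divfK// gt_eqF.
rewrite ler_piMr ?sqr_ge0//.
apply: (@le_trans _ _ (\sum_(n < N) (`|x n| / e) `^ p)); first exact: ler_sum.
under eq_bigr do rewrite powRM ?invr_ge0 ?(ltW e0)//.
rewrite -mulr_suml.
apply: (@le_trans _ _ (e `^ p * (e^-1) `^ p)); last first.
  by rewrite -powRM ?invr_ge0 ?(ltW e0)// mulfV ?gt_eqF// powR1.
rewrite ler_wpM2r ?powR_ge0//; apply: le_trans (ellp_sum_le x N) _.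
by rewrite ge0_ler_powR ?nnegrE ?(ltW p0) ?(ltW e0).
Qed.

Lemma ellp_sumE (I : Type) (r : seq I) (x : I -> ell) n :
  (\sum_(i <- r) x i) n = \sum_(i <- r) x i n.
Proof. by elim/big_rec2: _ => // i y1 y2 _ <-. Qed.

(** If [v <= z / 2] the first term suffices; otherwise [z <= 2 * v], and [2 ^ (p - 1) <= 2] since
    [p <= 2]. *)
Lemma powRB1_mul_le (z v : R) : p <= 2 -> 0 <= z -> 0 <= v ->
  z `^ (p - 1) * v <= z `^ p / 2 + 2 * v `^ p.
Proof.
move=> p2 z0 v0; have q0 : 0 <= p - 1 by rewrite subr_ge0.
have [h|h] := leP v (z / 2).
  have : z `^ (p - 1) * v <= z `^ (p - 1) * (z / 2) by rewrite ler_wpM2l ?powR_ge0.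
  rewrite mulrA (mulrC _ z) mulr_powRB1//.
  have := powR_ge0 v p; lra.
have zv : z <= 2 * v by lra.
have : z `^ (p - 1) * v <= (2 * v) `^ (p - 1) * v.
  by rewrite ler_wpM2r// ge0_ler_powR// nnegrE mulr_ge0.
rewrite powRM// -mulrA (mulrC (v `^ _)) mulr_powRB1//.
have : 2 `^ (p - 1) * v `^ p <= 2 * v `^ p.
  rewrite ler_wpM2r ?powR_ge0// -[leRHS]powRr1// ler_powR ?ler1n//; lra.
have := powR_ge0 z p; lra.
Qed.

(* Testing [z = \sum_n a_n x_n] against weights of modulus [|z_i|^(p-1)],
   Khinchine turns the l_2 norms of [y x_n] into averages over signs [e]; for
   fixed [e] the sum over [n] reduces to one finite partial sum of the series. *)
Lemma hirsch_bound (x : nat -> ell) (M e : R) (F : {fset nat}) (a : nat -> ell) :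
  p <= 2 -> 0 < M -> 0 < e ->
  (forall J : {fset nat}, `|\sum_(n <- J) x n| <= M) ->
  (forall n, n \in F -> `|a n| <= e) ->
  `|\sum_(n <- F) (a n * x n)%rng| <= 64 * (e * M).
Proof.
move=> p2 M0 e0 xM ae; set z : ell := \sum_(n <- F) _.
have eM0 : 0 <= e * M by rewrite mulr_ge0 ?ltW.
apply: ellp_norm_le => [|N]; first by rewrite mulr_ge0.
have /choice[y yE] : forall i, exists t : scalars R k, `|t| = `|z i| `^ (p - 1).
  by move=> i; apply: scalar_norm_surj; exact: powR_ge0.
set Z := \sum_(n < N) _.
pose b n i := x n i * y i.
have Z1 : Z <= \sum_(n <- F) \sum_(i < N) `|a n i| * `|b n i|.
  rewrite exchange_big /=; apply: ler_sum => i _.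
  rewrite -mulr_powRB1// -yE -scalar_normM /z ellp_sumE mulr_suml.
  apply: le_trans (ler_norm_sum _ _ _) _; apply: ler_sum => n _.
  by rewrite -scalar_normM /b mulrA.
have Z2 : Z <= \sum_(n <- F) e * (4 * sign_avg N (fun s => `|signed_sum (b n) N s|)).
  apply: (le_trans Z1); rewrite big_seq [leRHS]big_seq; apply: ler_sum => n nF.
  apply: le_trans (sum_mul_le_sqrt (f := fun i => `|a n i|) (fun i => `|b n i|) e0 _) _.
    by apply: ellp_sum_sqr_le => //; exact: ae.
  by rewrite ler_pM2l//; exact: khinchine.
(* The signs are fixed for the whole sum over [n], so that a single [J] can then be extracted. *)
have [s Z3] : exists s, Z <= 4 * e * \sum_(n <- F) `|signed_sum (b n) N s|.
  have [s hs] := sign_avg_le_value N (fun s => \sum_(n <- F) `|signed_sum (b n) N s|).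
  exists s; apply: (le_trans Z2).
  under eq_bigr do rewrite mulrCA mulrA.
  by rewrite -mulr_sumr -sign_avg_sum ler_pM2l// mulr_gt0.
have [J hJ] := sum_modulus_le_subset F (fun n => signed_sum (b n) N s).
pose w : ell := \sum_(n <- J) x n.
have sumJ : \sum_(n <- J) signed_sum (b n) N s = signed_sum (fun i => w i * y i) N s.
  rewrite /signed_sum exchange_big /=; apply: eq_bigr => i _.
  by rewrite -mulr_sumr /b -mulr_suml /w ellp_sumE.
(* 16 is 4 from Khinchine times 4 from the passage to [J]. *)
have Z4 : Z <= \sum_(i < N) `|z i| `^ (p - 1) * (16 * e * `|w i|).
  apply: (le_trans Z3).
  apply: (@le_trans _ _ (4 * e * (4 * \sum_(i < N) `|w i * y i|))).
    rewrite ler_pM2l ?mulr_gt0//; apply: (le_trans hJ).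
    by rewrite sumJ ler_pM2l// norm_signed_sum_le.
  rewrite mulrA mulr_sumr le_eqVlt; apply/orP; left; apply/eqP.
  by apply: eq_bigr => i _; rewrite scalar_normM yE; ring.
have Z5 : Z <= Z / 2 + 2 * \sum_(i < N) (16 * e * `|w i|) `^ p.
  apply: (le_trans Z4); rewrite mulr_suml mulr_sumr -big_split /=.
  by apply: ler_sum => i _; apply: powRB1_mul_le; rewrite ?mulr_ge0// ltW.
have e16 : 0 <= 16 * e by rewrite mulr_ge0// ltW.
have W : \sum_(i < N) (16 * e * `|w i|) `^ p <= (16 * (e * M)) `^ p.
  under eq_bigr do rewrite powRM//.
  rewrite -mulr_sumr mulrA [leRHS]powRM ?(ltW M0)// ler_wpM2l ?powR_ge0//.
  apply: le_trans (ellp_sum_le w N) _.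
  by rewrite ge0_ler_powR ?nnegrE ?(ltW p0) ?(ltW M0)//; exact: xM.
(* Absorbing [Z / 2] leaves a factor 4, which enters the [p]-th power because [4 <= 4 ^ p]. *)
have -> : 64 * (e * M) = 4 * (16 * (e * M)) by ring.
have v0 : 0 <= 16 * (e * M) by rewrite mulr_ge0.
rewrite powRM//.
have : 4 * (16 * (e * M)) `^ p <= 4 `^ p * (16 * (e * M)) `^ p.
  by rewrite ler_wpM2r ?powR_ge0// -[leLHS]powRr1// ler_powR ?ler1n.
lra.
Qed.

End UnconditionalConvergence.

Theorem corollary7p4 (R : realType) (F : scalar_kind) (p : R)
    (p1 : 1 <= p) (p2 : p <= 2) :
  Hirsch (@ellp R F p p1).
Proof.
move=> x /unconditionally_convergent_bounded[M M0 xM] U.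
move=> /nbhs_norm0P[r /= r0 rU].
(* 128 is twice the constant 64 of the bound, which thus becomes [r / 2 < r]. *)
have e0 : 0 < r / (128 * M) by rewrite divr_gt0// mulr_gt0.
exists [set y : ellp F p1 | `|y| < r / (128 * M)]%classic.
  by apply/nbhs_norm0P; exists (r / (128 * M)) => /=.
move=> J a aV; apply: rU => /=.
apply: le_lt_trans (hirsch_bound p2 M0 e0 xM (fun n nJ => ltW (aV n nJ))) _.
have -> : 64 * (r / (128 * M) * M) = r / 2 by field; rewrite gt_eqF.
by rewrite ltr_pdivrMr// ltr_pMr// ltr1n.
Qed.
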